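(* For every integer $n\ge 1$, the semigroup $T_n=\mathrm{Sg}\langle a,b\mid (ba)(ab)^n=(ba)^n\rangle$ is not LEF.
   Context: $\mathrm{Sg}\langle\cdot\mid\cdot\rangle$ denotes the semigroup given by a semigroup presentation. Maps are written on the right. A semigroup $S$ is LEF (locally embeddable into the class of finite semigroups) if for every finite subset $H$ of $S$ there exist a finite semigroup $F$ and an injective function $f:H\to F$ such that for all $x,y\in H$ with $xy\in H$ one has $(xy)f=(xf)(yf)$. *)

(* Defs.v *)
(* The congruence of a presentation need not be decidable, hence boolp. *)
From HB Require Import structures.
From mathcomp Require Import all_boot.
From mathcomp Require Import boolp finmap.

Set Implicit Arguments.
Unset Strict Implicit.
Unset Printing Implicit Defensive.

Local Open Scope group_scope.
Local Open Scope quotient_scope.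

#[short(type="finSemigroupType")]
HB.structure Definition FinSemigroup := {F of Semigroup F & Finite F}.

Definition LEF (S : semigroupType) : Prop :=
  forall H : {fset S}, exists (F : finSemigroupType) (f : H -> F),
    injective f /\
    forall x y z : H, val z = val x * val y -> f z = f x * f y.

(* The value at n = 0, where a semigroup has no power, is x. *)
Definition sgexp (S : semigroupType) (x : S) (n : nat) : S :=
  iterop n mul x x.

Record free_semigroup (A : choiceType) :=
  FreeSemigroup { word : seq A; _ : ~~ nilp word }.

Section FreeSemigroup.
Variable A : choiceType.

HB.instance Definition _ := [isSub for @word A].
HB.instance Definition _ := [Choice of free_semigroup A by <:].

Fact fs_mul_subproof (u v : free_semigroup A) : ~~ nilp (word u ++ word v).
Proof. by case: u => -[]. Qed.

Definition fs_mul (u v : free_semigroup A) : free_semigroup A :=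
  FreeSemigroup (fs_mul_subproof u v).

Fact fs_mulA : associative fs_mul.
Proof. by move=> u v w; apply: val_inj; rewrite /= catA. Qed.

HB.instance Definition _ := isSemigroup.Build (free_semigroup A) fs_mulA.

Definition fs_gen (a : A) : free_semigroup A :=
  @FreeSemigroup A [:: a] isT.

End FreeSemigroup.

Inductive congruence_closure (S : semigroupType) (R : S -> S -> Prop) :
    S -> S -> Prop :=
| cc_base u v : R u v -> congruence_closure R u v
| cc_refl u : congruence_closure R u u
| cc_sym u v : congruence_closure R u v -> congruence_closure R v u
| cc_trans v u w : congruence_closure R u v -> congruence_closure R v w ->
    congruence_closure R u w
| cc_mul u u' v v' : congruence_closure R u u' -> congruence_closure R v v' ->
    congruence_closure R (u * v) (u' * v').

Section Presentation.
Variables (A : choiceType).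
Variable R : free_semigroup A -> free_semigroup A -> Prop.

Definition pres_eq (u v : free_semigroup A) : bool :=
  `[< congruence_closure R u v >].

Fact pres_eq_refl : reflexive pres_eq.
Proof. by move=> u; apply/asboolP; exact: cc_refl. Qed.

Fact pres_eq_sym : symmetric pres_eq.
Proof. by move=> u v; apply/asboolP/asboolP; exact: cc_sym. Qed.

Fact pres_eq_trans : transitive pres_eq.
Proof. by move=> v u w /asboolP uv /asboolP vw; apply/asboolP/(cc_trans uv). Qed.

Canonical pres_eq_equiv := EquivRel pres_eq pres_eq_refl pres_eq_sym pres_eq_trans.

Definition Sg : Type := {eq_quot pres_eq}.
HB.instance Definition _ := Choice.on Sg.
HB.instance Definition _ := EqQuotient.on Sg.

Definition Sg_mul : Sg -> Sg -> Sg := lift_op2 Sg (@mul (free_semigroup A)).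

Lemma SgP (u v : free_semigroup A) :
  \pi_Sg u = \pi_Sg v <-> congruence_closure R u v.
Proof.
by split=> [/eqP|uv]; [rewrite eqmodE => /asboolP|apply/eqP; rewrite eqmodE; apply/asboolP].
Qed.

Fact pi_Sg_mul : {morph \pi_Sg : u v / u * v >-> Sg_mul u v}.
Proof.
by move=> u v; unlock Sg_mul; apply/SgP/cc_mul; apply/SgP; rewrite reprK.
Qed.
Canonical pi_Sg_mul_morph := PiMorph2 pi_Sg_mul.

Fact Sg_mulA : associative Sg_mul.
Proof. by elim/quotW=> u; elim/quotW=> v; elim/quotW=> w; rewrite !piE mulgA. Qed.

HB.instance Definition _ := isSemigroup.Build Sg Sg_mulA.

Lemma pi_SgM : {morph \pi_Sg : u v / u * v}.
Proof. exact: pi_Sg_mul. Qed.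

End Presentation.

(* The generators a and b are the two elements of bool. *)
Definition T_rel (n : nat) (u v : free_semigroup bool) : Prop :=
  let a := fs_gen false in let b := fs_gen true in
  u = (b * a) * sgexp (a * b) n /\ v = sgexp (b * a) n.

Definition T (n : nat) : semigroupType := Sg (T_rel n).

(* Main.v *)
Require Import Defs.
From mathcomp Require Import all_boot.
From mathcomp Require Import all_algebra zify.
From mathcomp Require Import finmap.

(** Write [d = ba] and [c = ab], and let [n = m + 1]. The relation of [T n] is
    [d c^n = d^n]. Since [c^k a = a d^k], it gives [(da) d^n = d^n a], hence
    [d^n a^k = (da)^k d^n] for every [k], and so, with the relation once more,
    [d^n a^k c^n = (da)^k d^(n+m) = d^n a^k d^m]. As [c^n = a d^m b], the words
    [x_k = d^n a^k d^m] satisfy [x_(k+1) b = x_k]: right multiplication by [b]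
    walks down the sequence. In a finite semigroup two terms of the sequence
    are equal, and walking down from them gives [x_0 = x_(p+1)] for some [p].
    Thus [x_0 b = x_p], so that [x_0 b] inherits the property
    [x_p c^n = x_p d^m] of the terms of the sequence, and this reads
    [d^(m+2n) b = d^(m+n) b d^m] because [b c^n = d^n b]
    ([finite_collapse]).

    This equation fails in [T n]. Indeed [T n] acts on the right on the pairs
    [(j, q)] of a natural number and a rational number, together with a sink,
    by [(j, q) a = (j+1, q)] and [(j+1, q) b = (j, q + (m/n)^j)], whereas
    [(0, q) b] is the sink. There [d] translates level [j+1] and [c]
    translates level [j], both by [(m/n)^j], so that the relation amounts to
    [(m/n)^j + n (m/n)^(j+1) = n (m/n)^j]. The two words send [(1, 0)] to
    different points ([levels_separate]).

    Since [T n] is finitely presented, being LEF would provide a finite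
    semigroup which satisfies the relation and separates these two words
    ([LEF_words]). All of this is phrased with automata, that is, with a set
    of states on which the letters act: the elements of a semigroup, together
    with an added initial state, form an automaton under right
    multiplication. *)

Set Implicit Arguments.
Unset Strict Implicit.
Unset Printing Implicit Defensive.

Import GRing.Theory Num.Theory.

Local Open Scope group_scope.
Local Open Scope quotient_scope.

(** * Semigroups as automata *)

Section RightMultiplication.
Variables (A : Type) (S : semigroupType) (g : A -> S).

(** [None] stands for the identity that a semigroup may lack: run from [None],
    a word reaches its value in [S], and the empty word has no value. *)
Definition mul_step (x : option S) (h : A) : option S :=
  Some (if x is Some y then y * g h else g h).

Definition value (w : seq A) : option S := foldl mul_step None w.

Lemma value_rcons w h : value (rcons w h) = mul_step (value w) h.
Proof. by rewrite /value -cats1 foldl_cat. Qed.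

Lemma foldl_mul_step y w :
  foldl mul_step (Some y) w = Some (if value w is Some z then y * z else y).
Proof.
elim/last_ind: w => [//|w h IHw].
rewrite value_rcons -cats1 foldl_cat IHw /= /mul_step.
by case: (value w) => // z; rewrite mulgA.
Qed.

Lemma value_eq_foldl w w' : value w = value w' ->
  forall x, foldl mul_step x w = foldl mul_step x w'.
Proof. by move=> eqw [y|//]; rewrite !foldl_mul_step eqw. Qed.

End RightMultiplication.

(** The partial map of the definition of LEF, extended by a default value, for
    which [x0] serves. *)
Lemma LEF_map (S : semigroupType) (x0 : S) (s : seq S) : LEF S ->
  exists (F : finSemigroupType) (phi : S -> F),
    {in s &, injective phi} /\
    (forall x y, x \in s -> y \in s -> x * y \in s ->
       phi (x * y) = phi x * phi y).
Proof.
move=> lefS; pose H := [fset x in x0 :: s]%fset.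
have [F [f [f_inj f_mul]]] := lefS H.
have x0H : x0 \in H by rewrite !inE eqxx.
have sH x : x \in s -> x \in H by rewrite !inE => ->; rewrite orbT.
exists F, (fun x => f (insubd [` x0H]%fset x)); split.
  move=> x y /sH xH /sH yH /f_inj /(congr1 val).
  by rewrite !insubdK.
by move=> x y /sH xH /sH yH /sH xyH; apply: f_mul; rewrite !insubdK.
Qed.

(** A finite semigroup can match a LEF semigroup on all short words. Equality
    of values goes both ways: one direction carries finitely many relations to
    the finite semigroup, the other separates words. *)
Lemma LEF_words (A : finType) (a0 : A) (S : semigroupType) (g : A -> S)
    (L : nat) : LEF S ->
  exists (F : finSemigroupType) (g' : A -> F),
    forall w w', size w <= L -> size w' <= L ->
      value g w = value g w' <-> value g' w = value g' w'.
Proof.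
move=> lefS.
pose s := pmap (fun w : L.+1.-bseq A => value g w) (enum {: L.+1.-bseq A}).
have sP w y : size w <= L.+1 -> value g w = Some y -> y \in s.
  move=> szw wy; rewrite mem_pmap -wy; apply/mapP.
  by exists (Bseq szw); rewrite ?mem_enum.
have [F [phi [phi_inj phi_mul]]] := LEF_map (g a0) s lefS.
exists F, (phi \o g).
have valueE w : size w <= L -> value (phi \o g) w = omap phi (value g w).
  elim/last_ind: w => [//|w h IHw]; rewrite size_rcons => szw.
  rewrite !value_rcons IHw ?(ltnW szw) //.
  case wy: (value g w) => [y|//]; congr Some; rewrite /= phi_mul //.
  - by apply: (sP w); rewrite // ltnW // ltnW.
  - exact: (sP [:: h]).
  - by apply: (sP (rcons w h)); rewrite ?size_rcons ?value_rcons ?wy // ltnW.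
move=> w w' szw szw'; rewrite !valueE //; split=> [-> //|].
case wy: (value g w) => [y|]; case wy': (value g w') => [y'|] //= [].
move=> /phi_inj -> //; first by apply: (sP w); rewrite // ltnW.
by apply: (sP w'); rewrite // ltnW.
Qed.

(** An automaton in which the relations hold is acted upon by the presented
    semigroup: one state whose images under two words differ is enough to tell
    the values of these words apart. *)
Lemma congruence_closure_foldl (A : choiceType)
    (R : free_semigroup A -> free_semigroup A -> Prop)
    (X : Type) (step : X -> A -> X) :
  (forall u v, R u v -> forall x,
     foldl step x (word u) = foldl step x (word v)) ->
  forall u v, congruence_closure R u v -> forall x,
    foldl step x (word u) = foldl step x (word v).
Proof.
move=> stepR u0 v0; elim=> //.
- by move=> v u w _ IHuv _ IHvw x; rewrite IHuv IHvw.
- by move=> u u' v v' _ IHu _ IHv x; rewrite /= !foldl_cat IHu IHv.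
Qed.

(** * The words of the presentation *)

Definition wpow (A : Type) (w : seq A) (k : nat) : seq A := flatten (nseq k w).

Lemma foldl_wpow (A X : Type) (step : X -> A -> X) w k x :
  foldl step x (wpow w k) = iter k (fun y => foldl step y w) x.
Proof.
elim: k x => [//|k IHk] x.
by rewrite /wpow /= foldl_cat -/(wpow w k) IHk -iterSr.
Qed.

Lemma word_sgexp (A : choiceType) (u : free_semigroup A) m :
  word (sgexp u m.+1) = wpow (word u) m.+1.
Proof.
elim: m => [|m IHm]; first by rewrite /wpow /= cats0.
exact: (congr1 (cat (word u)) IHm).
Qed.

(* As in the presentation, the letters a and b are false and true. *)
Notation wab := [:: false; true].
Notation wba := [:: true; false].

Definition lhs_word m := wba ++ wpow wab m.+1.
Definition rhs_word m := wpow wba m.+1.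

Lemma T_relP m u v :
  T_rel m.+1 u v <-> word u = lhs_word m /\ word v = rhs_word m.
Proof.
have eqword s t : s = t <-> word s = @word bool t.
  by split=> [-> //|/val_inj].
by rewrite /T_rel /= !eqword /= !word_sgexp.
Qed.

Definition T_gen n (h : bool) : T n := \pi_(Sg (T_rel n)) (fs_gen h).

Lemma value_T_gen n (u : free_semigroup bool) :
  value (T_gen n) (word u) = Some (\pi_(Sg (T_rel n)) u : T n).
Proof.
move wE: (word u) => w; elim/last_ind: w u wE => [[[]] //|w h IHw] u wE.
rewrite value_rcons; case: w IHw wE => [_|k w IHw] wE.
  by congr (Some (\pi _)); apply: val_inj; rewrite /= wE.
pose u' := FreeSemigroup (isT : ~~ nilp (k :: w)).
rewrite (IHw u') // /mul_step /T_gen -pi_SgM.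
by congr (Some (\pi _)); apply: val_inj; rewrite /= wE -cat_cons cats1.
Qed.

(** * The collapse in finite automata *)

Section FiniteCollapse.
Variables (X : finType) (A B : X -> X) (m : nat).

(* Letters act on the right, so that ba acts as the composite A \o B. *)
Let D x := A (B x).
Let C x := B (A x).

Hypothesis rel : forall x, iter m.+1 C (D x) = iter m.+1 D x.

Lemma A_iterC k x : A (iter k C x) = iter k D (A x).
Proof. by elim: k => //= k <-. Qed.

Lemma B_iterD k x : B (iter k D x) = iter k C (B x).
Proof. by elim: k => //= k <-. Qed.

Let x_ y k := iter m D (iter k A (iter m.+1 D y)).

(** The equation [d^n a^k = (da)^k d^n]. Past [a^k], the factor
    [d^n] meets what follows, where the relation applies to [d c^n]. *)
Lemma iterA_iterD k x :
  iter k A (iter m.+1 D x) = iter m.+1 D (iter k (A \o D) x).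
Proof. by elim: k => // k IHk; rewrite !iterS IHk -rel A_iterC. Qed.

Lemma iterC_iterD k y : iter m.+1 C (iter k.+1 D y) = iter m.+1 D (iter k D y).
Proof. by rewrite [iter k.+1 D y]iterS rel. Qed.

(** Since [b] turns [d^m] into [c^m] and [a b = c], the product [x_(k+1) b] is
    [d^n a^k c^n], where [d^n a^k = (da)^k d^n] makes [c^n] act as [d^m]. *)
Lemma B_x_S y k : B (x_ y k.+1) = x_ y k.
Proof.
rewrite /x_ B_iterD iterS -[B (A _)]/(C _) -iterSr iterA_iterD iterC_iterD.
by rewrite -!iterD addnC.
Qed.

Lemma iterC_x y k : iter m.+1 C (x_ y k) = iter m D (x_ y k).
Proof.
rewrite /x_ iterA_iterD -!iterD !addnS iterC_iterD -iterD.
by congr (iter _ D _); lia.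
Qed.

Lemma iterB_x y k i : iter i B (x_ y (i + k)) = x_ y k.
Proof. by elim: i => // i IHi; rewrite iterSr addSn B_x_S. Qed.

Lemma x_periodic y : exists p, x_ y 0 = x_ y p.+1.
Proof.
have /injectivePn [i [j neq_ij eq_ij]] :
    ~~ injectiveb (fun i : 'I_#|X|.+1 => x_ y i).
  apply/negP=> /injectiveP /leq_card.
  by rewrite card_ord ltnn.
wlog lt_ij : i j neq_ij eq_ij / i < j.
  move=> W; case: (ltngtP i j) => [|ji|/val_inj eqij]; first exact: W.
    by apply: (W j i) => //; rewrite eq_sym.
  by rewrite eqij eqxx in neq_ij.
exists (j - i).-1; rewrite prednK ?subn_gt0 //.
by rewrite -(iterB_x y 0 i) addn0 eq_ij -{1}(subnKC (ltnW lt_ij)) iterB_x.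
Qed.

Lemma finite_collapse y :
  B (iter (m + m.+1 + m.+1) D y) = iter m D (B (iter (m + m.+1) D y)).
Proof.
have [p x0E] := x_periodic y.
have -> : iter (m + m.+1) D y = x_ y 0 by rewrite iterD.
have -> : iter (m + m.+1 + m.+1) D y = iter m.+1 D (x_ y 0).
  by rewrite addnC iterD [iter (m + _) _ _]iterD.
by rewrite B_iterD x0E B_x_S iterC_x.
Qed.

End FiniteCollapse.

(** * An infinite automaton without the collapse *)

Section Levels.
Variable m : nat.

Local Open Scope ring_scope.

(** The translation lengths must satisfy [n t_(j+1) = m t_j]. For [m = 0] the
    powers [0^j] vanish from level one on, as they should. *)
Definition shift (j : nat) : rat := (m%:R / m.+1%:R) ^+ j.

Lemma shiftS j : shift j.+1 *+ m.+1 = shift j *+ m.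
Proof.
rewrite /shift exprSr -mulrnAr -[X in _ * X]mulr_natr divfK ?pnatr_eq0 //.
by rewrite mulr_natr.
Qed.

Definition levels_step (x : option (nat * rat)) (h : bool) :
    option (nat * rat) :=
  if x is Some (j, q) then
    if h then if j is i.+1 then Some (i, q + shift i) else None
    else Some (j.+1, q)
  else None.

Lemma levels_none w : foldl levels_step None w = None.
Proof. by elim: w. Qed.

Lemma levels_wba k j q :
  foldl levels_step (Some (j.+1, q)) (wpow wba k) =
    Some (j.+1, q + shift j *+ k).
Proof.
rewrite foldl_wpow; elim: k => [|k IHk]; first by rewrite addr0.
by rewrite iterS IHk mulrSr addrA.
Qed.

Lemma levels_wab k j q :
  foldl levels_step (Some (j, q)) (wpow wab k) = Some (j, q + shift j *+ k).
Proof.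
rewrite foldl_wpow; elim: k => [|k IHk]; first by rewrite addr0.
by rewrite iterS IHk mulrSr addrA.
Qed.

Lemma levels_rel x :
  foldl levels_step x (lhs_word m) = foldl levels_step x (rhs_word m).
Proof.
case: x => [[[|j] q]|]; rewrite ?levels_none ?levels_wba //.
  by rewrite /= -/(wpow wab m) !levels_none.
rewrite /lhs_word foldl_cat (levels_wba 1) levels_wab shiftS.
by rewrite mulr1n -addrA -mulrS.
Qed.

End Levels.

(** * The two words *)

Definition u_word m := wpow wba (m + m.+1 + m.+1) ++ [:: true].
Definition v_word m := wpow wba (m + m.+1) ++ true :: wpow wba m.

(* For m > 0 the second word falls into the sink, because it contains bb at
   level one; for m = 0 the two words end on level zero at different points. *)
Lemma levels_separate m :
  foldl (levels_step m) (Some (1%N, 0%R)) (u_word m) <>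
  foldl (levels_step m) (Some (1%N, 0%R)) (v_word m).
Proof.
rewrite /u_word /v_word !foldl_cat !levels_wba /=.
case: m => [|m]; last by rewrite /wpow /= levels_none.
by case.
Qed.

Lemma finite_words m (X : finType) (step : X -> bool -> X) :
  (forall x, foldl step x (lhs_word m) = foldl step x (rhs_word m)) ->
  forall x, foldl step x (u_word m) = foldl step x (v_word m).
Proof.
move=> rel x; rewrite /u_word /v_word !foldl_cat /= !foldl_wpow /=.
apply: (@finite_collapse X (step^~ false) (step^~ true)) => y.
by have:= rel y; rewrite /lhs_word foldl_cat !foldl_wpow.
Qed.

Theorem corollary2 (n : nat) (hn : (1 <= n)%N) : ~ LEF (T n).
Proof.
case: n hn => // m _ lefT.
have nonempty (w : seq bool) :
    0 < size w -> {u : free_semigroup bool | word u = w}.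
  by move=> w0; exists (@FreeSemigroup _ w ltac:(by case: w w0)).
have [l lE] : {u : free_semigroup bool | word u = lhs_word m}.
  exact: nonempty.
have [r rE] : {u : free_semigroup bool | word u = rhs_word m}.
  exact: nonempty.
have [u uE] : {u : free_semigroup bool | word u = u_word m}.
  by apply: nonempty; rewrite size_cat addn1.
have [v vE] : {u : free_semigroup bool | word u = v_word m}.
  by apply: nonempty; rewrite size_cat addnS.
pose L := size (lhs_word m ++ rhs_word m ++ u_word m ++ v_word m).
have [F [g eq_value]] := LEF_words false (T_gen m.+1) L lefT.
have relF x : foldl (mul_step g) x (lhs_word m) =
              foldl (mul_step g) x (rhs_word m).
  apply: value_eq_foldl; apply/eq_value; rewrite ?/L ?size_cat; try lia.
  rewrite -lE -rE !value_T_gen; congr Some.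
  by apply/SgP/cc_base/T_relP.
have : value (T_gen m.+1) (u_word m) = value (T_gen m.+1) (v_word m).
  apply/eq_value; rewrite ?/L ?size_cat; try lia.
  exact: (finite_words relF).
rewrite -uE -vE !value_T_gen => -[/SgP cc_uv].
apply: (@levels_separate m); rewrite -uE -vE.
apply: (congruence_closure_foldl _ cc_uv) => s t /T_relP [-> ->] x.
exact: levels_rel.
Qed.
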